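(* With the data described in the context — sending a modal box $(M,X)$ to the set $\mathcal{P}(M,X)$ of modal dynamical systems on it, sending a mode-dependent network $(\epsilon,\sigma)\colon(M,X)\to(N,Y)$ to the function $\mathcal{P}(\epsilon,\sigma)\colon\mathcal{P}(M,X)\to\mathcal{P}(N,Y)$, $(S,q,f)\mapsto(S,r,g)$, and equipped with the coherence maps $\mathcal{P}(M,X)\times\mathcal{P}(N,Y)\to\mathcal{P}(M\times N,X\sqcup Y)$ and $\{\ast\}\to\mathcal{P}(\{\ast\},\emptyset)$ — the map $\mathcal{P}\colon\mathsf{MDN}\to\mathsf{Set}$ is a lax monoidal functor, where $\mathsf{MDN}$ is the symmetric monoidal category of mode-dependent networks and $\mathsf{Set}$ has the cartesian monoidal structure.
   Context: **Typed finite sets.** $\mathsf{TFS}$ is the category whose objects are pairs $(A,\tau)$ with $A$ a finite set and $\tau\colon A\to\mathsf{Set}$ a function assigning to each $a\in A$ a set $\tau(a)$ (its type); a morphism $q\colon(A,\tau)\to(A',\tau')$ is a function $q\colon A\to A'$ with $\tau'\circ q=\tau$. It is monoidal under disjoint union $\sqcup$. The dependent product of $(A,\tau)$ is the set $\overline{A}=\prod_{a\in A}\tau(a)$. A morphism $q\colon A\to A'$ induces $\overline{q}\colon\overline{A'}\to\overline{A}$, $\overline{q}(x)_a=x_{q(a)}$, giving a functor $\mathsf{TFS}^{\mathrm{op}}\to\mathsf{Set}$, and there is an isomorphism $\overline{A\sqcup B}\cong\overline{A}\times\overline{B}$. **Wiring diagrams.** A box is a pair $X=(X^{\mathrm{in}},X^{\mathrm{out}})$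 of typed finite sets. A wiring diagram $\varphi\colon X\to Y$ is a pair of $\mathsf{TFS}$-morphisms $\varphi^{\mathrm{in}}\colon X^{\mathrm{in}}\to Y^{\mathrm{in}}\sqcup X^{\mathrm{out}}$ and $\varphi^{\mathrm{out}}\colon Y^{\mathrm{out}}\to X^{\mathrm{out}}$. The composite of $\varphi\colon X\to Y$ and $\psi\colon Y\to Z$ has $(\psi\circ\varphi)^{\mathrm{out}}=\varphi^{\mathrm{out}}\circ\psi^{\mathrm{out}}$, and $(\psi\circ\varphi)^{\mathrm{in}}$ is the composite $$X^{\mathrm{in}}\xrightarrow{\varphi^{\mathrm{in}}}Y^{\mathrm{in}}\sqcup X^{\mathrm{out}}\xrightarrow{\psi^{\mathrm{in}}\sqcup\mathrm{id}}Z^{\mathrm{in}}\sqcup Y^{\mathrm{out}}\sqcup X^{\mathrm{out}}\to Z^{\mathrm{in}}\sqcup X^{\mathrm{out}},$$ where the last map is the identity on $Z^{\mathrm{in}}$ and on $X^{\mathrm{out}}$ and is $\varphi^{\mathrm{out}}$ on $Y^{\mathrm{out}}$. This gives the category $\mathsf{WD}$ of boxes and wiring diagrams, symmetric monoidal under disjoint union $(X\sqcup Y)^{\mathrm{in}}=X^{\mathrm{in}}\sqcup Y^{\mathrm{in}}$, $(X\sqcup Y)^{\mathrm{out}}=X^{\mathrm{out}}\sqcup Y^{\mathrm{out}}$ (similarly on morphisms); its unit is the box $\emptyset$ with no ports. **Mode-dependent networks.** $\mathsf{MDN}$ is the following symmetric monoidal category. An object (modal box) is a pair $(M,X)$ with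 $M$ a set (the mode set) and $X\colon M\to\mathrm{Ob}\,\mathsf{WD}$ a function. A morphism $(M,X)\to(N,Y)$ (mode-dependent network) is a pair $(\epsilon,\sigma)$ with $\sigma\colon M\to N$ a function and $\epsilon$ a function assigning to each $m\in M$ a wiring diagram $\epsilon(m)\colon X(m)\to Y(\sigma(m))$. The composite of $(\epsilon_0,\sigma_0)\colon(M_0,X_0)\to(M_1,X_1)$ and $(\epsilon_1,\sigma_1)\colon(M_1,X_1)\to(M_2,X_2)$ is $(\epsilon,\sigma_1\circ\sigma_0)$ with $\epsilon(m_0)=\epsilon_1(\sigma_0(m_0))\circ\epsilon_0(m_0)$. The monoidal product is $(M,X)\otimes(N,Y)=(M\times N,X\sqcup Y)$ where $(X\sqcup Y)(m,n)=X(m)\sqcup Y(n)$, similarly on morphisms; the unit is $(\{\ast\},\emptyset)$. For a morphism $(\epsilon,\sigma)\colon(M,X)\to(N,Y)$ and $m\in M$, write $\epsilon^{\mathrm{in}}(m),\epsilon^{\mathrm{out}}(m)$ for the two components of the wiring diagram $\epsilon(m)$. Taking dependent products gives functions $$\overline{\epsilon^{\mathrm{in}}}(m)\colon\overline{Y^{\mathrm{in}}}(\sigma(m))\times\overline{X^{\mathrm{out}}}(m)\to\overline{X^{\mathrm{in}}}(m),\qquad \overline{\epsilon^{\mathrm{out}}}(m)\colon\overline{X^{\mathrm{out}}}(m)\to\overline{Y^{\mathrm{out}}}(\sigma(m)),$$ where $\overline{X^{\mathrm{in}}}(m)=\overline{X(m)^{\mathrm{in}}}$, etc. **The data of $\mathcal{P}$.**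 *On objects:* $\mathcal{P}(M,X)$ is the set of tuples $(S,q,f^{\mathrm{in}},f^{\mathrm{out}})$, also written $(S,q,f)$ and called modal dynamical systems, where $S$ is a set (state set), $q\colon S\to M$ is a function (underlying mode function), $f^{\mathrm{in}}$ assigns to each $s\in S$ a function $f^{\mathrm{in}}(s)\colon\overline{X^{\mathrm{in}}}(q(s))\to S$ (state update), and $f^{\mathrm{out}}$ assigns to each $s\in S$ an element $f^{\mathrm{out}}(s)\in\overline{X^{\mathrm{out}}}(q(s))$ (readout). *On morphisms:* for $(\epsilon,\sigma)\colon(M,X)\to(N,Y)$, $\mathcal{P}(\epsilon,\sigma)(S,q,f)=(S,r,g)$, where $r=\sigma\circ q$ and, for each $s\in S$ with $m=q(s)$, $$g^{\mathrm{out}}(s)=\overline{\epsilon^{\mathrm{out}}}(m)\big(f^{\mathrm{out}}(s)\big),\qquad g^{\mathrm{in}}(s)(y)=f^{\mathrm{in}}(s)\Big(\overline{\epsilon^{\mathrm{in}}}(m)\big(y,f^{\mathrm{out}}(s)\big)\Big)\quad\text{for } y\in\overline{Y^{\mathrm{in}}}(\sigma(m)).$$ *Coherence maps:* $\mathcal{P}(M,X)\times\mathcal{P}(N,Y)\to\mathcal{P}(M\times N,X\sqcup Y)$ is given by cartesian products: it sends $\big((S_X,q_X,f_X),(S_Y,q_Y,f_Y)\big)$ to $(S_X\times S_Y,\;q_X\times q_Y,\;f_X\times f_Y)$, where, via the isomorphisms $\overline{A\sqcup B}\cong\overline{A}\times\overline{B}$, $(f_X\times f_Y)^{\mathrm{in}}(s,t)(x,y)=\big(f_X^{\mathrm{in}}(s)(x),f_Y^{\mathrm{in}}(t)(y)\big)$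 and $(f_X\times f_Y)^{\mathrm{out}}(s,t)=\big(f_X^{\mathrm{out}}(s),f_Y^{\mathrm{out}}(t)\big)$. The unit coherence map $\{\ast\}\to\mathcal{P}(\{\ast\},\emptyset)$ picks out $(\{\ast\},!,!,!)$, each $!$ being the unique morphism of the evident type.
   Formalization: On literal tuples (S,q,f) the associativity and unit diagrams fail, since e.g. {∗}×S is not S; they are stated up to the canonical bijection of state sets, and the lax monoidal functor is asserted for systems up to isomorphism of state sets. Functoriality and naturality stay literal. *)

(* Defs.v *)
Set Warnings "-notation-overridden".
From mathcomp Require Import all_boot.
From Stdlib Require Import FunctionalExtensionality PropExtensionality.
From Stdlib Require Import ProofIrrelevance ClassicalEpsilon.

Set Implicit Arguments.
Unset Strict Implicit.
Unset Printing Implicit Defensive.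

Declare Scope cat_scope.
Delimit Scope cat_scope with cat.
Local Open Scope cat_scope.

Record category := Category {
  ob :> Type;
  hom : ob -> ob -> Type;
  idm : forall a, hom a a;
  comp : forall a b c, hom b c -> hom a b -> hom a c;
  comp_idl : forall a b (f : hom a b), comp (idm b) f = f;
  comp_idr : forall a b (f : hom a b), comp f (idm a) = f;
  compA : forall a b c d (f : hom a b) (g : hom b c) (h : hom c d),
    comp h (comp g f) = comp (comp h g) f }.

Arguments hom {_} _ _.
Arguments idm {_} _.
Arguments comp {_ _ _ _} _ _.

Notation "g ∘ f" := (comp g f) (at level 40, left associativity) : cat_scope.

Record sym_mon_cat := SymMonCat {
  smc_cat :> category;
  tens : smc_cat -> smc_cat -> smc_cat;
  tensh : forall a a' b b' : smc_cat,
    hom a a' -> hom b b' -> hom (tens a b) (tens a' b');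
  munit : smc_cat;
  tensh_id : forall a b : smc_cat, tensh (idm a) (idm b) = idm (tens a b);
  tensh_comp : forall (a a' a'' b b' b'' : smc_cat)
      (f : hom a a') (f' : hom a' a'') (g : hom b b') (g' : hom b' b''),
    tensh (f' ∘ f) (g' ∘ g) = tensh f' g' ∘ tensh f g;
  assoc : forall a b c, hom (tens (tens a b) c) (tens a (tens b c));
  assoc_inv : forall a b c, hom (tens a (tens b c)) (tens (tens a b) c);
  assocK : forall a b c, assoc_inv a b c ∘ assoc a b c = idm _;
  assocVK : forall a b c, assoc a b c ∘ assoc_inv a b c = idm _;
  assoc_nat : forall (a a' b b' c c' : smc_cat)
      (f : hom a a') (g : hom b b') (h : hom c c'),
    assoc a' b' c' ∘ tensh (tensh f g) h = tensh f (tensh g h) ∘ assoc a b c;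
  lunit : forall a, hom (tens munit a) a;
  lunit_inv : forall a, hom a (tens munit a);
  lunitK : forall a, lunit_inv a ∘ lunit a = idm _;
  lunitVK : forall a, lunit a ∘ lunit_inv a = idm _;
  lunit_nat : forall (a a' : smc_cat) (f : hom a a'),
    lunit a' ∘ tensh (idm munit) f = f ∘ lunit a;
  runit : forall a, hom (tens a munit) a;
  runit_inv : forall a, hom a (tens a munit);
  runitK : forall a, runit_inv a ∘ runit a = idm _;
  runitVK : forall a, runit a ∘ runit_inv a = idm _;
  runit_nat : forall (a a' : smc_cat) (f : hom a a'),
    runit a' ∘ tensh f (idm munit) = f ∘ runit a;
  triangle : forall a b,
    tensh (idm a) (lunit b) ∘ assoc a munit b = tensh (runit a) (idm b);
  pentagon : forall a b c d,
    assoc a b (tens c d) ∘ assoc (tens a b) c d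
    = tensh (idm a) (assoc b c d) ∘ assoc a (tens b c) d
      ∘ tensh (assoc a b c) (idm d);
  braid : forall a b, hom (tens a b) (tens b a);
  braidK : forall a b, braid b a ∘ braid a b = idm _;
  braid_nat : forall (a a' b b' : smc_cat) (f : hom a a') (g : hom b b'),
    braid a' b' ∘ tensh f g = tensh g f ∘ braid a b;
  hexagon : forall a b c,
    assoc b c a ∘ braid a (tens b c) ∘ assoc a b c
    = tensh (idm b) (braid a c) ∘ assoc b a c ∘ tensh (braid a b) (idm c) }.

Arguments tens {_} _ _.
Arguments tensh {_ _ _ _ _} _ _.
Arguments munit {_}.
Arguments assoc {_} _ _ _.
Arguments assoc_inv {_} _ _ _.
Arguments lunit {_} _.
Arguments lunit_inv {_} _.
Arguments runit {_} _.
Arguments runit_inv {_} _.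
Arguments braid {_} _ _.

Notation "a ⊗ b" := (tens a b) (at level 38, left associativity) : cat_scope.
Notation "f ⊠ g" := (tensh f g) (at level 38, left associativity) : cat_scope.

Record is_functor (C D : category) (F0 : C -> D)
    (F1 : forall a b, hom a b -> hom (F0 a) (F0 b)) : Prop := IsFunctor {
  functor_id : forall a, F1 a a (idm a) = idm (F0 a);
  functor_comp : forall a b c (f : hom a b) (g : hom b c),
    F1 a c (g ∘ f) = F1 b c g ∘ F1 a b f }.

Definition natural_laxator (C D : sym_mon_cat) (F0 : C -> D)
    (F1 : forall a b, hom a b -> hom (F0 a) (F0 b))
    (mu : forall a b, hom (F0 a ⊗ F0 b) (F0 (a ⊗ b))) : Prop :=
  forall (a a' b b' : C) (f : hom a a') (g : hom b b'),
    mu a' b' ∘ (F1 a a' f ⊠ F1 b b' g) = F1 _ _ (f ⊠ g) ∘ mu a b.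

Record is_lax_monoidal_functor (C D : sym_mon_cat) (F0 : C -> D)
    (F1 : forall a b, hom a b -> hom (F0 a) (F0 b))
    (mu : forall a b, hom (F0 a ⊗ F0 b) (F0 (a ⊗ b)))
    (eta : hom munit (F0 munit)) : Prop := IsLaxMonoidalFunctor {
  lax_functor : is_functor F1;
  lax_natural : natural_laxator F1 mu;
  lax_assoc : forall a b c : C,
    F1 _ _ (assoc a b c) ∘ mu (a ⊗ b) c ∘ (mu a b ⊠ idm (F0 c))
    = mu a (b ⊗ c) ∘ (idm (F0 a) ⊠ mu b c) ∘ assoc (F0 a) (F0 b) (F0 c);
  lax_lunit : forall a : C,
    F1 _ _ (lunit a) ∘ mu munit a ∘ (eta ⊠ idm (F0 a)) = lunit (F0 a);
  lax_runit : forall a : C,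
    F1 _ _ (runit a) ∘ mu a munit ∘ (idm (F0 a) ⊠ eta) = runit (F0 a) }.

Definition SET_cat : category.
Proof.
by refine {| ob := Type; hom := fun A B => A -> B; idm := fun A x => x;
  comp := fun A B C g f x => g (f x) |}.
Defined.

Definition SET : sym_mon_cat.
Proof.
refine {| smc_cat := SET_cat;
  tens := fun A B : Type => (A * B)%type;
  tensh := fun A A' B B' (f : A -> A') (g : B -> B') (p : A * B) =>
    (f p.1, g p.2);
  munit := unit;
  assoc := fun (A B C : Type) (p : A * B * C) => (p.1.1, (p.1.2, p.2));
  assoc_inv := fun (A B C : Type) (p : A * (B * C)) => ((p.1, p.2.1), p.2.2);
  lunit := fun (A : Type) (p : unit * A) => p.2;
  lunit_inv := fun (A : Type) (a : A) => (tt, a);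
  runit := fun (A : Type) (p : A * unit) => p.1;
  runit_inv := fun (A : Type) (a : A) => (a, tt);
  braid := fun (A B : Type) (p : A * B) => (p.2, p.1) |} => //=;
  intros; apply: functional_extensionality => p;
  by repeat (match goal with
             | x : (_ * _)%type |- _ => destruct x
             | x : unit |- _ => destruct x end).
Defined.

Record tfs := Tfs { port :> finType; typ : port -> Type }.

Record tfs_hom (A B : tfs) := TfsHom {
  tfun :> A -> B;
  tfunE : forall a, typ (tfun a) = typ a }.

Lemma tfs_ext (A B : tfs) (f g : tfs_hom A B) : (forall a, f a = g a) -> f = g.
Proof.
case: f g => f Hf [g Hg] /= /functional_extensionality E.
by case: _ / E Hg => Hg; rewrite (proof_irrelevance _ Hf Hg).
Qed.

Definition tfs_id (A : tfs) : tfs_hom A A :=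
  {| tfun := fun a => a; tfunE := fun a => erefl |}.

Definition tfs_comp (A B C : tfs) (g : tfs_hom B C) (f : tfs_hom A B) :
    tfs_hom A C :=
  {| tfun := fun a => g (f a); tfunE := fun a => etrans (tfunE g (f a)) (tfunE f a) |}.

Definition TFS : category.
Proof.
by refine {| ob := tfs; hom := tfs_hom; idm := tfs_id; comp := tfs_comp |};
  intros; apply: tfs_ext.
Defined.

Definition tfs_empty : tfs :=
  {| port := void; typ := fun v : void => match v with end |}.

Definition tfs_sum (A B : tfs) : tfs :=
  {| port := (A + B)%type;
     typ := fun s : A + B => match s with inl a => typ a | inr b => typ b end |}.

Notation "A ⊔ B" := (tfs_sum A B) (at level 50, left associativity) : cat_scope.

Definition tfs_init (A : tfs) : tfs_hom tfs_empty A :=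
  {| tfun := fun v : tfs_empty => match v with end;
     tfunE := fun v : tfs_empty => match v with end |}.

Definition tfs_inl (A B : tfs) : tfs_hom A (A ⊔ B) :=
  @TfsHom A (A ⊔ B) (fun a => inl a) (fun a => erefl).

Definition tfs_inr (A B : tfs) : tfs_hom B (A ⊔ B) :=
  @TfsHom B (A ⊔ B) (fun b => inr b) (fun b => erefl).

Arguments tfs_inl {A B}.
Arguments tfs_inr {A B}.

Definition tfs_copair (A B C : tfs) (f : tfs_hom A C) (g : tfs_hom B C) :
    tfs_hom (A ⊔ B) C :=
  @TfsHom (A ⊔ B) C
    (fun s => match s with inl a => f a | inr b => g b end)
    (fun s => match s with inl a => tfunE f a | inr b => tfunE g b end).

Definition tfs_sumh (A A' B B' : tfs) (f : tfs_hom A A') (g : tfs_hom B B') :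
    tfs_hom (A ⊔ B) (A' ⊔ B') :=
  tfs_copair (tfs_comp tfs_inl f) (tfs_comp tfs_inr g).

Definition tfs_assoc (A B C : tfs) : tfs_hom (A ⊔ B ⊔ C) (A ⊔ (B ⊔ C)) :=
  tfs_copair (tfs_copair tfs_inl (tfs_comp tfs_inr tfs_inl))
    (tfs_comp tfs_inr tfs_inr).

Definition tfs_assoc_inv (A B C : tfs) : tfs_hom (A ⊔ (B ⊔ C)) (A ⊔ B ⊔ C) :=
  tfs_copair (tfs_comp tfs_inl tfs_inl)
    (tfs_copair (tfs_comp tfs_inl tfs_inr) tfs_inr).

Definition tfs_lunit (A : tfs) : tfs_hom (tfs_empty ⊔ A) A :=
  tfs_copair (tfs_init A) (tfs_id A).

Definition tfs_runit (A : tfs) : tfs_hom (A ⊔ tfs_empty) A :=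
  tfs_copair (tfs_id A) (tfs_init A).

Definition tfs_swap (A B : tfs) : tfs_hom (A ⊔ B) (B ⊔ A) :=
  tfs_copair tfs_inr tfs_inl.

Definition tfs_interchange (A B C D : tfs) :
    tfs_hom ((A ⊔ B) ⊔ (C ⊔ D)) ((A ⊔ C) ⊔ (B ⊔ D)) :=
  tfs_copair (tfs_sumh tfs_inl tfs_inl) (tfs_sumh tfs_inr tfs_inr).

Definition dprod (A : tfs) : Type := forall a : A, typ a.

Definition dprod_map (A B : tfs) (f : tfs_hom A B) (x : dprod B) : dprod A :=
  fun a => eq_rect (typ (f a)) (fun T => T) (x (f a)) (typ a) (tfunE f a).

Definition dprod_pair (A B : tfs) (x : dprod A) (y : dprod B) : dprod (A ⊔ B) :=
  fun s => match s return typ (s : A ⊔ B) with inl a => x a | inr b => y b end.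

Definition dprod_fst (A B : tfs) (z : dprod (A ⊔ B)) : dprod A :=
  fun a => z (inl a).

Definition dprod_snd (A B : tfs) (z : dprod (A ⊔ B)) : dprod B :=
  fun b => z (inr b).

Lemma dprod_pairK (A B : tfs) (z : dprod (A ⊔ B)) :
  dprod_pair (dprod_fst z) (dprod_snd z) = z.
Proof. by apply: functional_extensionality_dep => -[]. Qed.

Record box := Box { bin : tfs; bout : tfs }.

Record wiring (X Y : box) := Wiring {
  win : tfs_hom (bin X) (bin Y ⊔ bout X);
  wout : tfs_hom (bout Y) (bout X) }.

Lemma wiring_ext (X Y : box) (f g : wiring X Y) :
  (forall a, win f a = win g a) -> (forall b, wout f b = wout g b) -> f = g.
Proof.
case: f g => [fi fo] [gi go] Ei Eo; have := tfs_ext Ei; have := tfs_ext Eo.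
by move=> /= -> ->.
Qed.

Definition wd_id (X : box) : wiring X X :=
  {| win := tfs_inl; wout := tfs_id (bout X) |}.

Definition wd_comp (X Y Z : box) (psi : wiring Y Z) (phi : wiring X Y) :
    wiring X Z :=
  {| win := tfs_comp
       (tfs_copair (tfs_copair tfs_inl (tfs_comp tfs_inr (wout phi))) tfs_inr)
       (tfs_comp (tfs_sumh (win psi) (tfs_id (bout X))) (win phi));
     wout := tfs_comp (wout phi) (wout psi) |}.

Definition wd_empty : box := {| bin := tfs_empty; bout := tfs_empty |}.

Definition wd_sum (X Y : box) : box :=
  {| bin := bin X ⊔ bin Y; bout := bout X ⊔ bout Y |}.

Definition wd_sumh (X X' Y Y' : box) (f : wiring X X') (g : wiring Y Y') :
    wiring (wd_sum X Y) (wd_sum X' Y') :=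
  @Wiring (wd_sum X Y) (wd_sum X' Y')
    (tfs_comp (tfs_interchange (bin X') (bout X) (bin Y') (bout Y))
       (tfs_sumh (win f) (win g)))
    (tfs_sumh (wout f) (wout g)).

(* The coherence isomorphisms of WD come from those of (TFS, ⊔): they wire each
   inner input to an outer input and pass no output back. *)
Definition wd_of (X Y : box) (f : tfs_hom (bin X) (bin Y))
    (g : tfs_hom (bout Y) (bout X)) : wiring X Y :=
  {| win := tfs_comp tfs_inl f; wout := g |}.

Definition WD_cat : category.
Proof.
refine {| ob := box; hom := wiring; idm := wd_id; comp := wd_comp |}; intros;
  apply: wiring_ext => //= x.
- by case: (win f x).
- by case: (win f x).
- by case: (win f x) => //= y; case: (win g y) => //= z; case: (win h z).
Defined.

Definition WD : sym_mon_cat.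
Proof.
refine {| smc_cat := WD_cat;
  tens := wd_sum : WD_cat -> WD_cat -> WD_cat; tensh := wd_sumh;
  munit := wd_empty;
  assoc := fun X Y Z : box =>
    @wd_of (wd_sum (wd_sum X Y) Z) (wd_sum X (wd_sum Y Z))
      (tfs_assoc _ _ _) (tfs_assoc_inv _ _ _);
  assoc_inv := fun X Y Z : box =>
    @wd_of (wd_sum X (wd_sum Y Z)) (wd_sum (wd_sum X Y) Z)
      (tfs_assoc_inv _ _ _) (tfs_assoc _ _ _);
  lunit := fun X : box =>
    @wd_of (wd_sum wd_empty X) X (tfs_lunit _) tfs_inr;
  lunit_inv := fun X : box =>
    @wd_of X (wd_sum wd_empty X) tfs_inr (tfs_lunit _);
  runit := fun X : box =>
    @wd_of (wd_sum X wd_empty) X (tfs_runit _) tfs_inl;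
  runit_inv := fun X : box =>
    @wd_of X (wd_sum X wd_empty) tfs_inl (tfs_runit _);
  braid := fun X Y : box =>
    @wd_of (wd_sum X Y) (wd_sum Y X) (tfs_swap _ _) (tfs_swap _ _) |}; intros;
  apply: wiring_ext => /= x;
  repeat match goal with
    | s : (_ + _)%type |- _ => destruct s; simpl
    | v : void |- _ => destruct v
    end;
  repeat match goal with
    | |- context [@tfun _ _ (win ?f) ?y] => generalize (win f y) => -[?|?] /=
    end; done.
Defined.

Record modal_box := ModalBox { mode : Type; mbox : mode -> WD }.

Record network (X Y : modal_box) := Network {
  nmode : mode X -> mode Y;
  nwire : forall m, @hom WD (mbox m) (mbox (nmode m)) }.

Lemma network_ext (X Y : modal_box) (f g : network X Y) :
  (forall m, existT (fun n => @hom WD (mbox m) (mbox n)) (nmode f m) (nwire f m)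
           = existT (fun n => @hom WD (mbox m) (mbox n)) (nmode g m) (nwire g m)) ->
  f = g.
Proof.
move=> E.
pose tot (m : mode X) := {n : mode Y & @hom WD (mbox m) (mbox n)}.
pose un (h : network X Y) m : tot m := existT _ (nmode h m) (nwire h m).
pose mk (h : forall m, tot m) : network X Y :=
  {| nmode := fun m => projT1 (h m); nwire := fun m => projT2 (h m) |}.
have K h : h = mk (un h) by case: h.
have U : un f = un g by apply: functional_extensionality_dep.
by rewrite (K f) U -K.
Qed.

Definition mdn_id (X : modal_box) : network X X :=
  {| nmode := fun m => m; nwire := fun m => idm (mbox m) |}.

Definition mdn_comp (X Y Z : modal_box) (g : network Y Z) (f : network X Y) :
    network X Z :=
  {| nmode := fun m => nmode g (nmode f m);
     nwire := fun m => nwire g (nmode f m) ∘ nwire f m |}.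

Definition mdn_tens (X Y : modal_box) : modal_box :=
  {| mode := mode X * mode Y; mbox := fun p => mbox p.1 ⊗ mbox p.2 |}.

Definition mdn_tensh (X X' Y Y' : modal_box) (f : network X X') (g : network Y Y') :
    network (mdn_tens X Y) (mdn_tens X' Y') :=
  @Network (mdn_tens X Y) (mdn_tens X' Y')
    (fun p => (nmode f p.1, nmode g p.2))
    (fun p => nwire f p.1 ⊠ nwire g p.2).

Definition mdn_unit : modal_box :=
  {| mode := unit; mbox := fun _ => munit |}.

Definition MDN_cat : category.
Proof.
refine {| ob := modal_box; hom := network; idm := mdn_id; comp := mdn_comp |};
  intros; apply: network_ext => m; congr existT.
- exact: comp_idl.
- exact: comp_idr.
- exact: compA.
Defined.

Definition MDN : sym_mon_cat.
Proof.
refine {| smc_cat := MDN_cat;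
  tens := mdn_tens : MDN_cat -> MDN_cat -> MDN_cat; tensh := mdn_tensh;
  munit := mdn_unit;
  assoc := fun X Y Z : modal_box =>
    @Network (mdn_tens (mdn_tens X Y) Z) (mdn_tens X (mdn_tens Y Z))
      (fun p => (p.1.1, (p.1.2, p.2))) (fun p => assoc _ _ _);
  assoc_inv := fun X Y Z : modal_box =>
    @Network (mdn_tens X (mdn_tens Y Z)) (mdn_tens (mdn_tens X Y) Z)
      (fun p => ((p.1, p.2.1), p.2.2)) (fun p => assoc_inv _ _ _);
  lunit := fun X : modal_box =>
    @Network (mdn_tens mdn_unit X) X (fun p => p.2) (fun p => lunit _);
  lunit_inv := fun X : modal_box =>
    @Network X (mdn_tens mdn_unit X) (fun m => (tt, m)) (fun m => lunit_inv _);
  runit := fun X : modal_box =>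
    @Network (mdn_tens X mdn_unit) X (fun p => p.1) (fun p => runit _);
  runit_inv := fun X : modal_box =>
    @Network X (mdn_tens X mdn_unit) (fun m => (m, tt)) (fun m => runit_inv _);
  braid := fun X Y : modal_box =>
    @Network (mdn_tens X Y) (mdn_tens Y X) (fun p => (p.2, p.1))
      (fun p => braid _ _) |}; intros; apply: network_ext => m;
  repeat (match goal with
    | x : mode (mdn_tens _ _) |- _ => destruct x
    | x : mode mdn_unit |- _ => destruct x end); congr existT.
- exact: tensh_id.
- exact: tensh_comp.
- exact: assocK.
- exact: assocVK.
- exact: assoc_nat.
- exact: lunitK.
- exact: lunit_nat.
- exact: runitK.
- exact: runit_nat.
- exact: triangle.
- exact: pentagon.
- exact: braidK.
- exact: braid_nat.
- exact: hexagon.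
Defined.

Definition wd_dprod_in (X Y : box) (phi : wiring X Y)
    (y : dprod (bin Y)) (x : dprod (bout X)) : dprod (bin X) :=
  dprod_map (win phi) (dprod_pair y x).

Definition wd_dprod_out (X Y : box) (phi : wiring X Y)
    (x : dprod (bout X)) : dprod (bout Y) :=
  dprod_map (wout phi) x.

Record mds (X : modal_box) := Mds {
  state : Type;
  smode : state -> mode X;
  update : forall s, dprod (bin (mbox (smode s))) -> state;
  readout : forall s, dprod (bout (mbox (smode s))) }.

Arguments smode {X} m s.
Arguments update {X} m s x.
Arguments readout {X} m s.

Definition P_obj (X : MDN) : SET := mds X.

Definition P_hom (X Y : MDN) (e : hom X Y) : hom (P_obj X) (P_obj Y) :=
  fun F : mds X => @Mds Y (state F)
    (fun s => nmode e (smode F s))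
    (fun s y => update F s (wd_dprod_in (nwire e (smode F s)) y (readout F s)))
    (fun s => wd_dprod_out (nwire e (smode F s)) (readout F s)).

Definition P_mu (X Y : MDN) : hom (P_obj X ⊗ P_obj Y) (P_obj (X ⊗ Y)) :=
  fun FG : mds X * mds Y => let (F, G) := FG in
    @Mds (mdn_tens X Y) (state F * state G)
      (fun p => (smode F p.1, smode G p.2))
      (fun p z => (update F p.1 (dprod_fst z), update G p.2 (dprod_snd z)))
      (fun p => dprod_pair (readout F p.1) (readout G p.2)).

Arguments P_mu : clear implicits.

Definition P_eta : hom munit (P_obj munit) :=
  fun _ : unit => @Mds mdn_unit unit (fun _ => tt) (fun _ _ => tt)
    (fun _ (v : tfs_empty) => match v with end).

(* P_hom is strictly functorial and P_mu strictly natural, because both sides of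
   these equations have the same state set. The associativity and unit diagrams
   instead compare systems whose state sets are, e.g., (S * T) * U and
   S * (T * U): these are identified only along a canonical bijection, so their
   commutation is read up to renaming of states along it. *)

Definition mds_rename (X : modal_box) (S : Type) (F : mds X)
    (h : S -> state F) (k : state F -> S) : mds X :=
  @Mds X S (fun s => smode F (h s)) (fun s x => k (update F (h s) x))
    (fun s => readout F (h s)).

Definition mds_iso (X : modal_box) (F G : mds X) : Prop :=
  exists (S : Type) (h : S -> state G) (k : state G -> S),
    [/\ cancel h k, cancel k h & F = mds_rename h k].

Lemma mds_rename_id (X : modal_box) (F : mds X) (h k : state F -> state F) :
  h =1 id -> k =1 id -> mds_rename h k = F.
Proof.
move=> /functional_extensionality -> /functional_extensionality ->.
by case: F {h k}.
Qed.

Lemma mds_iso_refl (X : modal_box) (F : mds X) : mds_iso F F.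
Proof. by exists (state F), id, id; split=> //; rewrite mds_rename_id. Qed.

Lemma mds_iso_sym (X : modal_box) (F G : mds X) : mds_iso F G -> mds_iso G F.
Proof.
case=> S [h [k [hK kK ->]]]; exists (state G), k, h; split=> //.
by rewrite -[LHS](@mds_rename_id X G (fun s => h (k s)) (fun s => h (k s))).
Qed.

Lemma mds_iso_trans (X : modal_box) (F G H : mds X) :
  mds_iso F G -> mds_iso G H -> mds_iso F H.
Proof.
case=> S [h [k [hK kK ->]]] [T [h' [k' [hK' kK' E]]]].
rewrite {}E in h k hK kK *.
exists S, (fun s => h' (h s)), (fun s => k (k' s)); split=> // s /=.
- by rewrite hK' hK.
- by rewrite kK kK'.
Qed.

Lemma mds_iso_P_hom (X Y : MDN) (e : hom X Y) (F F' : mds X) :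
  mds_iso F F' -> mds_iso (P_hom e F) (P_hom e F').
Proof. by case=> S [h [k [hK kK ->]]]; exists S, h, k. Qed.

Lemma mds_iso_P_mu (X Y : MDN) (F F' : mds X) (G G' : mds Y) :
  mds_iso F F' -> mds_iso G G' ->
  mds_iso (P_mu X Y (F, G)) (P_mu X Y (F', G')).
Proof.
case=> S [h [k [hK kK ->]]] [T [h' [k' [hK' kK' ->]]]].
exists (S * T)%type, (fun p => (h p.1, h' p.2)), (fun p => (k p.1, k' p.2)).
by split=> // -[s t] /=; rewrite ?hK ?hK' ?kK ?kK'.
Qed.

Definition quot (T : Type) (R : T -> T -> Prop) : Type :=
  {C : T -> Prop | exists x, C = R x}.

Definition cls (T : Type) (R : T -> T -> Prop) (x : T) : quot R :=
  exist _ (R x) (ex_intro _ x erefl).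

Definition repr (T : Type) (R : T -> T -> Prop) (C : quot R) : T :=
  proj1_sig (constructive_indefinite_description _ (proj2_sig C)).

Lemma reprK (T : Type) (R : T -> T -> Prop) (C : quot R) : cls R (repr C) = C.
Proof.
have := proj2_sig (constructive_indefinite_description _ (proj2_sig C)).
rewrite -/(repr C); case: C (repr C) => C HC x /= E.
apply: eq_exist_uncurried; exists (esym E); exact: proof_irrelevance.
Qed.

(* The maps on classes act on chosen representatives; Pq_homE and Pq_muE show
   that the choice is immaterial. *)
Definition Pq_obj (X : MDN) : SET := quot (@mds_iso X).

Definition mds_class (X : MDN) (F : mds X) : Pq_obj X := cls (@mds_iso X) F.

Lemma mds_classP (X : MDN) (F G : mds X) :
  mds_class F = mds_class G <-> mds_iso F G.
Proof.
split=> [[E]|FG].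
  by rewrite E; apply: mds_iso_refl.
have E : mds_iso F = mds_iso G.
  apply: functional_extensionality => H; apply: propositional_extensionality.
  by split; apply: mds_iso_trans => //; apply: mds_iso_sym.
rewrite /mds_class /cls; apply: eq_exist_uncurried; exists E.
exact: proof_irrelevance.
Qed.

Definition Pq_hom (X Y : MDN) (e : hom X Y) : hom (Pq_obj X) (Pq_obj Y) :=
  fun C : Pq_obj X => mds_class (P_hom e (repr C)).

Definition Pq_mu (X Y : MDN) : hom (Pq_obj X ⊗ Pq_obj Y) (Pq_obj (X ⊗ Y)) :=
  fun CD : Pq_obj X * Pq_obj Y => mds_class (P_mu X Y (repr CD.1, repr CD.2)).

Arguments Pq_mu : clear implicits.

Definition Pq_eta : hom munit (Pq_obj munit) :=
  fun u : unit => mds_class (P_eta u).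

Lemma repr_class (X : MDN) (F : mds X) : mds_iso (repr (mds_class F)) F.
Proof. by apply/mds_classP; rewrite /mds_class reprK. Qed.

Lemma Pq_homE (X Y : MDN) (e : hom X Y) (F : mds X) :
  Pq_hom e (mds_class F) = mds_class (P_hom e F).
Proof. by apply/mds_classP/mds_iso_P_hom/repr_class. Qed.

Lemma Pq_muE (X Y : MDN) (F : mds X) (G : mds Y) :
  Pq_mu X Y (mds_class F, mds_class G) = mds_class (P_mu X Y (F, G)).
Proof. by apply/mds_classP/mds_iso_P_mu; apply: repr_class. Qed.

(* Main.v *)
Set Warnings "-notation-overridden".
From mathcomp Require Import all_boot.
From Stdlib Require Import FunctionalExtensionality.
Require Import Defs.
Local Open Scope cat_scope.

(** The dependent product is a contravariant functor on typed finite sets that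
    turns disjoint unions into products. Applied to the formula for composing
    wiring diagrams, this says that the inputs of the inner box are computed in
    two stages: read off the outputs [x] of the inner box, push them forward to
    outputs of the middle box, use these to find the inputs of the middle box,
    and then use those together with [x] ([wd_dprod_in_comp]). That is exactly
    how two successive applications of [P_hom] act, so [P_hom] is a functor; and
    a disjoint union of wiring diagrams acts componentwise
    ([wd_dprod_in_sum]), so the laxator is natural.

    The coherence isomorphisms of boxes only relabel ports, so they act on
    dependent products by rebracketing tuples or by dropping an empty factor.
    Hence the associativity and unit diagrams commute once the state sets are
    rebracketed by the same bijections, which are those of the cartesian product
    of sets.

    Finally, maps out of a quotient are determined on classes, where [Pq_hom] and
    [Pq_mu] are given by [P_hom] and [P_mu]. The diagrams for classes therefore
    follow from those for systems, since renaming the states along a bijection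
    does not change the class ([mds_class_rename]). *)

(** * Dependent products of typed finite sets *)

Lemma dprod_ext (A : tfs) (x y : dprod A) : (forall a, x a = y a) -> x = y.
Proof. exact: functional_extensionality_dep. Qed.

Lemma dprod_map_id (A : tfs) (x : dprod A) : dprod_map (tfs_id A) x = x.
Proof. by []. Qed.

Lemma dprod_map_comp (A B C : tfs) (g : tfs_hom B C) (f : tfs_hom A B)
    (x : dprod C) :
  dprod_map (tfs_comp g f) x = dprod_map f (dprod_map g x).
Proof. by apply: dprod_ext => a; rewrite /dprod_map rew_compose. Qed.

Lemma dprod_map_copair (A B C : tfs) (f : tfs_hom A C) (g : tfs_hom B C)
    (x : dprod C) :
  dprod_map (tfs_copair f g) x = dprod_pair (dprod_map f x) (dprod_map g x).
Proof. by apply: dprod_ext => -[]. Qed.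

Lemma dprod_map_inl (A B : tfs) (x : dprod (A ⊔ B)) :
  dprod_map tfs_inl x = dprod_fst x.
Proof. by []. Qed.

Lemma dprod_map_inr (A B : tfs) (x : dprod (A ⊔ B)) :
  dprod_map tfs_inr x = dprod_snd x.
Proof. by []. Qed.

Lemma dprod_fst_pair (A B : tfs) (x : dprod A) (y : dprod B) :
  dprod_fst (dprod_pair x y) = x.
Proof. by []. Qed.

Lemma dprod_snd_pair (A B : tfs) (x : dprod A) (y : dprod B) :
  dprod_snd (dprod_pair x y) = y.
Proof. by []. Qed.

(** The structure maps of typed finite sets are all built from these
    constructions, so these rules compute their action on dependent products. *)
Definition dprodE := (dprod_map_comp, dprod_map_copair, dprod_map_inl,
  dprod_map_inr, dprod_map_id, dprod_fst_pair, dprod_snd_pair).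

Lemma dprod_map_sumh (A A' B B' : tfs) (f : tfs_hom A A') (g : tfs_hom B B')
    (x : dprod (A' ⊔ B')) :
  dprod_map (tfs_sumh f g) x
  = dprod_pair (dprod_map f (dprod_fst x)) (dprod_map g (dprod_snd x)).
Proof. by rewrite /tfs_sumh !dprodE. Qed.

(** * Action of wiring diagrams on dependent products *)

(** The middle box receives [z] from outside, and its outputs are those that
    [phi] exports from the inner box. *)
Lemma wd_dprod_in_comp (X Y Z : box) (psi : wiring Y Z) (phi : wiring X Y)
    (z : dprod (bin Z)) (x : dprod (bout X)) :
  wd_dprod_in (wd_comp psi phi) z x
  = wd_dprod_in phi (wd_dprod_in psi z (wd_dprod_out phi x)) x.
Proof. by rewrite /wd_dprod_in /= !(dprodE, dprod_map_sumh). Qed.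

Lemma wd_dprod_out_comp (X Y Z : box) (psi : wiring Y Z) (phi : wiring X Y)
    (x : dprod (bout X)) :
  wd_dprod_out (wd_comp psi phi) x = wd_dprod_out psi (wd_dprod_out phi x).
Proof. exact: dprod_map_comp. Qed.

Lemma wd_dprod_in_sum (X X' Y Y' : box) (f : wiring X X') (g : wiring Y Y')
    (z : dprod (bin X' ⊔ bin Y')) (x : dprod (bout X)) (y : dprod (bout Y)) :
  wd_dprod_in (wd_sumh f g) z (dprod_pair x y)
  = dprod_pair (wd_dprod_in f (dprod_fst z) x)
      (wd_dprod_in g (dprod_snd z) y).
Proof.
by rewrite /wd_dprod_in /tfs_interchange /= !(dprodE, dprod_map_sumh).
Qed.

Lemma wd_dprod_out_sum (X X' Y Y' : box) (f : wiring X X') (g : wiring Y Y')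
    (x : dprod (bout X)) (y : dprod (bout Y)) :
  wd_dprod_out (wd_sumh f g) (dprod_pair x y)
  = dprod_pair (wd_dprod_out f x) (wd_dprod_out g y).
Proof. exact: dprod_map_sumh. Qed.

(** Such a diagram feeds no output back, so the inputs it computes ignore the
    outputs [x]. *)
Lemma wd_dprod_in_of (X Y : box) (f : tfs_hom (bin X) (bin Y))
    (g : tfs_hom (bout Y) (bout X)) (y : dprod (bin Y)) (x : dprod (bout X)) :
  wd_dprod_in (wd_of f g) y x = dprod_map f y.
Proof. by rewrite /wd_dprod_in /= !dprodE. Qed.

(** * Modal dynamical systems *)

(** The mode function is shared rather than equated, so that the updates and
    readouts to be compared have the same type. *)
Lemma mds_ext (X : modal_box) (S : Type) (q : S -> mode X)
    (u u' : forall s, dprod (bin (mbox (q s))) -> S)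
    (r r' : forall s, dprod (bout (mbox (q s)))) :
  (forall s x, u s x = u' s x) -> (forall s, r s = r' s) ->
  @Mds X S q u r = @Mds X S q u' r'.
Proof.
move=> Eu Er; have -> : u = u'.
  by do 2!apply: functional_extensionality_dep => ?.
by have -> : r = r' by apply: functional_extensionality_dep.
Qed.

Lemma P_functor : is_functor (C := MDN) (D := SET) P_hom.
Proof.
split=> [X|X Y Z f g]; apply: functional_extensionality => F /=.
  by case: F => S q u r; apply: mds_ext.
apply: mds_ext => [s z|s] /=.
  by rewrite wd_dprod_in_comp.
by rewrite wd_dprod_out_comp.
Qed.

Lemma P_mu_natural : natural_laxator (C := MDN) (D := SET) P_hom P_mu.
Proof.
move=> X X' Y Y' f g; apply: functional_extensionality => -[F G] /=.
apply: mds_ext => [[s t] z|[s t]] /=.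
  by rewrite wd_dprod_in_sum.
by rewrite wd_dprod_out_sum.
Qed.

Lemma P_assoc (X Y Z : MDN) (F : mds X) (G : mds Y) (H : mds Z) :
  P_hom (assoc X Y Z) (P_mu (X ⊗ Y) Z (P_mu X Y (F, G), H))
  = mds_rename (S := state F * state G * state H)
      (F := P_mu X (Y ⊗ Z) (F, P_mu Y Z (G, H)))
      (@assoc SET (state F) (state G) (state H))
      (@assoc_inv SET (state F) (state G) (state H)).
Proof.
apply: mds_ext => [[[s t] v] z|[[s t] v]] /=.
  by rewrite wd_dprod_in_of /tfs_assoc !dprodE.
by rewrite /wd_dprod_out /= /tfs_assoc_inv !dprodE.
Qed.

(** The unit system has no ports, so once its single state is destructed both
    systems compute the same updates and readouts. *)
Lemma P_lunit (X : MDN) (F : mds X) :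
  P_hom (lunit X) (P_mu munit X (P_eta tt, F))
  = mds_rename (S := unit * state F) (F := F)
      (@lunit SET (state F)) (@lunit_inv SET (state F)).
Proof.
by apply: mds_ext => [[[] s] x|[[] s]].
Qed.

Lemma P_runit (X : MDN) (F : mds X) :
  P_hom (runit X) (P_mu X munit (F, P_eta tt))
  = mds_rename (S := state F * unit) (F := F)
      (@runit SET (state F)) (@runit_inv SET (state F)).
Proof.
by apply: mds_ext => [[s []] x|[s []]].
Qed.

(** * Classes of systems up to renaming of states *)

Lemma mds_class_ind (X : MDN) (P : Pq_obj X -> Prop) :
  (forall F, P (mds_class F)) -> forall C, P C.
Proof. by move=> PF C; have <- := reprK C; apply: PF. Qed.

Lemma mds_class_rename (X : MDN) (S : Type) (F : mds X)
    (h : S -> state F) (k : state F -> S) :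
  cancel h k -> cancel k h -> mds_class (mds_rename h k) = mds_class F.
Proof. by move=> hK kK; apply/mds_classP; exists S, h, k. Qed.

Lemma Pq_functor : is_functor (C := MDN) (D := SET) Pq_hom.
Proof.
have [P_id P_comp] := P_functor.
split=> [X|X Y Z f g]; apply: functional_extensionality;
  apply: mds_class_ind => F /=; rewrite !Pq_homE.
- by rewrite P_id.
- by rewrite (P_comp X Y Z f g).
Qed.

Lemma Pq_mu_natural : natural_laxator (C := MDN) (D := SET) Pq_hom Pq_mu.
Proof.
move=> X X' Y Y' f g; apply: functional_extensionality => -[C D] /=.
elim/mds_class_ind: C => F; elim/mds_class_ind: D => G.
rewrite !(Pq_homE, Pq_muE).
by have /(congr1 (fun h => h (F, G))) /= -> := P_mu_natural X X' Y Y' f g.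
Qed.

Lemma Pq_lax_monoidal :
  is_lax_monoidal_functor (C := MDN) (D := SET) Pq_hom Pq_mu Pq_eta.
Proof.
split; [exact: Pq_functor | exact: Pq_mu_natural | | |].
- move=> X Y Z; apply: functional_extensionality => -[[A B] C].
  elim/mds_class_ind: A => F; elim/mds_class_ind: B => G.
  elim/mds_class_ind: C => H.
  change (Pq_hom (assoc X Y Z) (Pq_mu (X ⊗ Y) Z
      (Pq_mu X Y (mds_class F, mds_class G), mds_class H))
    = Pq_mu X (Y ⊗ Z) (mds_class F, Pq_mu Y Z (mds_class G, mds_class H))).
  rewrite !Pq_muE Pq_homE P_assoc.
  by apply: mds_class_rename => [[[]]|[? []]].
- move=> X; apply: functional_extensionality => -[[] C] /=.
  elim/mds_class_ind: C => F.
  rewrite /Pq_eta Pq_muE Pq_homE P_lunit.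
  by apply: mds_class_rename => [[[]]|].
- move=> X; apply: functional_extensionality => -[C []] /=.
  elim/mds_class_ind: C => F.
  rewrite /Pq_eta Pq_muE Pq_homE P_runit.
  by apply: mds_class_rename => [[? []]|].
Qed.

Theorem proposition4p4 :
  is_functor (C := MDN) (D := SET) P_hom
  /\ natural_laxator (C := MDN) (D := SET) P_hom P_mu
  /\ (forall (X Y Z : MDN) (F : mds X) (G : mds Y) (H : mds Z),
        P_hom (assoc X Y Z) (P_mu (X ⊗ Y) Z (P_mu X Y (F, G), H))
        = mds_rename (S := state F * state G * state H)
            (F := P_mu X (Y ⊗ Z) (F, P_mu Y Z (G, H)))
            (@assoc SET (state F) (state G) (state H))
            (@assoc_inv SET (state F) (state G) (state H)))
  /\ (forall (X : MDN) (F : mds X),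
        P_hom (lunit X) (P_mu munit X (P_eta tt, F))
        = mds_rename (S := unit * state F) (F := F)
            (@lunit SET (state F)) (@lunit_inv SET (state F)))
  /\ (forall (X : MDN) (F : mds X),
        P_hom (runit X) (P_mu X munit (F, P_eta tt))
        = mds_rename (S := state F * unit) (F := F)
            (@runit SET (state F)) (@runit_inv SET (state F)))
  /\ is_lax_monoidal_functor (C := MDN) (D := SET) Pq_hom Pq_mu Pq_eta.
Proof.
exact: (conj P_functor (conj P_mu_natural (conj P_assoc
  (conj P_lunit (conj P_runit Pq_lax_monoidal))))).
Qed.
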